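(* Let $\mathbf{E}$ be a discrete vector bundle with discrete connection $\boldsymbol{\nabla}$ over a discrete manifold $M$, and let $\boldsymbol{\Omega}^{\boldsymbol{\nabla}}$ be its discrete curvature. For any $3$-simplex $\sigma=[v_0,v_1,v_2,v_3]\subset M$ one has $$\boldsymbol{d}^{\boldsymbol{\nabla}}\boldsymbol{\Omega}^{\boldsymbol{\nabla}}(\sigma,v_0,v_3)=0 .$$
   Context: A discrete manifold is an oriented manifold represented by a simplicial complex. A discrete vector bundle $\mathbf{E}$ of rank $r$ assigns to each vertex $v$ an $r$-dimensional real vector space $\mathbf{E}_v$. A discrete connection $\boldsymbol{\nabla}=\{\mathcal{R}_{ij}\}$ assigns to each oriented edge $e_{ij}$ an invertible linear map $\mathcal{R}_{ij}=\mathcal{R}_{v_i,v_j}\colon\mathbf{E}_{v_j}\to\mathbf{E}_{v_i}$ with $\mathcal{R}_{ij}\mathcal{R}_{ji}=\mathrm{Id}$; by convention $\mathcal{R}_{v,v}=\mathrm{Id}$. A discrete $(1,1)$-tensor-valued $\ell$-form $\boldsymbol{\beta}$ assigns to each oriented $\ell$-simplex $\sigma$ and vertices $v$ (evaluation) and $w$ (cut) of $\sigma$ a linear map $\boldsymbol{\beta}(\sigma,v,w)\in\mathrm{Hom}(\mathbf{E}_w,\mathbf{E}_v)$, with $\boldsymbol{\beta}(\bar\sigma,v,w)=-\boldsymbol{\beta}(\sigma,v,w)$ for reversed orientation $\bar\sigma$. The discrete curvature is the discrete $(1,1)$-tensor-valued $2$-form given on a triangle $\sigma=[v_0,v_1,v_2]$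 by $\boldsymbol{\Omega}^{\boldsymbol{\nabla}}(\sigma,v_0,v_1)=\mathcal{R}_{01}-\mathcal{R}_{02}\mathcal{R}_{21}$, $\boldsymbol{\Omega}^{\boldsymbol{\nabla}}(\sigma,v_0,v_2)=\mathcal{R}_{01}\mathcal{R}_{12}-\mathcal{R}_{02}$, $\boldsymbol{\Omega}^{\boldsymbol{\nabla}}(\sigma,v_0,v_0)=\mathcal{R}_{01}\mathcal{R}_{12}\mathcal{R}_{20}-\mathrm{Id}$. For $\sigma=[v_0,\ldots,v_{\ell+1}]$ write $\sigma_{v_i}=[v_0,\ldots,\hat v_i,\ldots,v_{\ell+1}]$. The sided derivative of a discrete $(1,1)$-tensor-valued $\ell$-form is defined on ordered simplices by $$\mathfrak{d}^{\boldsymbol{\nabla}}\boldsymbol{\beta}(\sigma,v_0,v_{\ell+1})=\mathcal{R}_{01}\boldsymbol{\beta}(\sigma_{v_0},v_1,v_{\ell+1})+\sum_{i=1}^{\ell}(-1)^i\boldsymbol{\beta}(\sigma_{v_i},v_0,v_{\ell+1})+(-1)^{\ell+1}\boldsymbol{\beta}(\sigma_{v_{\ell+1}},v_0,v_\ell)\mathcal{R}_{\ell,\ell+1}.$$ The alternation of an assignment $\boldsymbol{\gamma}([v_0,\ldots,v_k],v_0,v_k)\in\mathrm{Hom}(\mathbf{E}_{v_k},\mathbf{E}_{v_0})$ on ordered $k$-simplices is $$\mathrm{Alt}^{\boldsymbol{\nabla}}\boldsymbol{\gamma}([v_0,\ldots,v_k],v_0,v_k)=\frac{1}{(k+1)!}\sum_{\pi\in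 S_{k+1}}\Big(\tfrac{1+\mathrm{sgn}(\pi)}{2}\mathcal{R}_{v_0,v_{\pi(0)}}\boldsymbol{\gamma}_\pi\,\mathcal{R}_{v_{\pi(k)},v_k}+\tfrac{\mathrm{sgn}(\pi)-1}{2}\mathcal{R}_{v_0,v_{\pi(0)}}\boldsymbol{\gamma}_\pi\,\mathcal{R}_{v_{\pi(k)},v_{\pi(k-1)}}\mathcal{R}_{v_{\pi(k-1)},v_k}\Big),$$ where $\boldsymbol{\gamma}_\pi=\boldsymbol{\gamma}([v_{\pi(0)},\ldots,v_{\pi(k)}],v_{\pi(0)},v_{\pi(k)})$ and $S_{k+1}$ is the group of permutations of $\{0,\ldots,k\}$. The discrete exterior covariant derivative is $\boldsymbol{d}^{\boldsymbol{\nabla}}\boldsymbol{\beta}=\mathrm{Alt}^{\boldsymbol{\nabla}}\mathfrak{d}^{\boldsymbol{\nabla}}\boldsymbol{\beta}$. *)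

(* Defs.v *)
From HB Require Import structures.
From mathcomp Require Import all_boot all_order all_algebra all_fingroup.
From mathcomp Require Import finmap.
From mathcomp Require Import all_classical all_reals all_analysis.

Set Implicit Arguments.
Unset Strict Implicit.
Unset Printing Implicit Defensive.

Import Order.TTheory GRing.Theory Num.Theory.
Import numFieldNormedType.Exports.

Local Open Scope classical_set_scope.
Local Open Scope ring_scope.

Record complex := Complex {
  vertex : choiceType;
  simplices : set {fset vertex};
  simplices_neq0 : forall A, simplices A -> A != fset0;
  simplices_sub : forall A B : {fset vertex},
    simplices A -> (B `<=` A)%fset -> B != fset0 -> simplices B;
  simplices_vertex : forall v : vertex, simplices [fset v]%fset }.

Definition locally_finite (K : complex) :=
  forall v : vertex K, finite_set [set A | simplices A /\ v \in A].

Section Realization.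
Variables (R : realType) (K : complex).

(* Barycentric coordinates. *)
Definition realization_set : set {ptws vertex K -> R} :=
  [set x | (forall v, 0 <= x v) /\
     exists2 A : {fset vertex K}, simplices A &
       (forall v, v \notin A -> x v = 0) /\ \sum_(v <- A) x v = 1].

(* For a locally finite complex, the topology of pointwise convergence of
   barycentric coordinates is the usual (coherent) topology of |K|. *)
Definition realization : topologicalType :=
  initial_topology (@set_val _ realization_set).

End Realization.

(* R^n for n = 0, the half-space of vectors with nonnegative first coordinate
   otherwise. *)
Definition half_space (R : realType) (n : nat) : set 'rV[R]_n :=
  [set y | forall i : 'I_n, i = 0%N :> nat -> 0 <= y ord0 i].

Definition chart_at (R : realType) (n : nat) (X : topologicalType) (x : X) :=
  exists (U : set X) (O : set 'rV[R]_n) (f : X -> 'rV[R]_n) (g : 'rV[R]_n -> X),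
  let W := O `&` @half_space R n in
  [/\ open U /\ U x, open O, f @` U = W /\ (forall p, U p -> g (f p) = p),
      {within U, continuous f} & {within W, continuous g}].

(* Topological n-manifold; the boundary may be empty or not. *)
Definition is_manifold (R : realType) (n : nat) (X : topologicalType) :=
  [/\ hausdorff_space X, @second_countable X & forall x : X, chart_at R n x].

(* A k-simplex [v_0, ..., v_k] together with an ordering of its vertices. *)
Record osimplex (K : complex) (k : nat) := OSimplex {
  overtex :> 'I_k.+1 -> vertex K;
  overtex_inj : injective overtex;
  overtex_simplex : simplices [fset overtex i | i in 'I_k.+1]%fset }.

Section OrderedSimplices.
Variables (K : complex) (k : nat).

Lemma osimplex_perm_subproof (s : osimplex K k) (p : 'S_k.+1) :
  simplices [fset s (p i) | i in 'I_k.+1]%fset.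
Proof.
have -> : [fset s (p i) | i in 'I_k.+1]%fset = [fset s i | i in 'I_k.+1]%fset.
  apply/fsetP => v; apply/imfsetP/imfsetP => -[i _ ->].
    by exists (p i).
  by exists ((p^-1)%g i) => //; rewrite permKV.
exact: overtex_simplex.
Qed.

(* [v_(p 0), ..., v_(p k)] *)
Definition osimplex_perm (s : osimplex K k) (p : 'S_k.+1) : osimplex K k :=
  OSimplex (inj_comp (@overtex_inj _ _ s) (@perm_inj _ p))
           (osimplex_perm_subproof s p).

Lemma osimplex_face_subproof (s : osimplex K k.+1) (i : 'I_k.+2) :
  simplices [fset s (lift i j) | j in 'I_k.+1]%fset.
Proof.
apply: (simplices_sub (overtex_simplex s)).
  by apply/fsubsetP => v /imfsetP[j _ ->]; apply/imfsetP; exists (lift i j).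
apply/fset0Pn; exists (s (lift i ord0)); apply/imfsetP.
by exists ord0.
Qed.

(* s_(v_i): the i-th vertex is omitted. *)
Definition osimplex_face (s : osimplex K k.+1) (i : 'I_k.+2) : osimplex K k :=
  OSimplex (inj_comp (@overtex_inj _ _ s) (@lift_inj _ i))
           (osimplex_face_subproof s i).

End OrderedSimplices.

(* A choice of an orientation of every k-simplex: the positive orderings of a
   simplex form one of the two classes modulo even permutations. *)
Record simplex_orientation (K : complex) (k : nat) := SimplexOrientation {
  positive :> osimplex K k -> bool;
  positive_perm : forall (s : osimplex K k) (p : 'S_k.+1),
    positive (osimplex_perm s p) = positive s (+) odd_perm p }.

Lemma simplex_orientation_exists (K : complex) (k : nat) :
  inhabited (simplex_orientation K k).
Proof.
pose A (s : osimplex K k) := [fset s i | i in 'I_k.+1]%fset.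
have sA (s : osimplex K k) i : s i \in enum_fset (A s) by apply/imfsetP; exists i.
have szA (s : osimplex K k) : size (enum_fset (A s)) = k.+1.
  by rewrite card_imfset ?size_enum_ord -?cardE ?card_ord //=; exact: overtex_inj.
have ltA (s : osimplex K k) i : (index (s i) (enum_fset (A s)) < k.+1)%N.
  by rewrite -[X in (_ < X)%N](szA s) index_mem.
pose f (s : osimplex K k) i : 'I_k.+1 := Ordinal (ltA s i).
have f_inj s : injective (f s).
  by move=> i j [] /(index_inj (s i) (sA s i) (sA s j)) /overtex_inj.
have AE (s : osimplex K k) p : A (osimplex_perm s p) = A s.
  apply/fsetP => v; apply/imfsetP/imfsetP => -[i _ ->].
    by exists (p i).
  by exists ((p^-1)%g i) => //=; rewrite permKV.
constructor; apply: (@SimplexOrientation K k (fun s => odd_perm (perm (@f_inj s)))).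
move=> s p; have -> : perm (@f_inj (osimplex_perm s p)) = (p * perm (@f_inj s))%g.
  by apply/permP => i; rewrite permM !permE; apply/val_inj; rewrite /= AE.
by rewrite odd_permM addbC.
Qed.

(* Two n-simplices [a, w_1, ..., w_n] and [b, w_1, ..., w_n] with a <> b, ordered
   so as to agree on their common facet, must have opposite signs. *)
Definition coherent (K : complex) (n : nat) (o : simplex_orientation K n) :=
  forall s t : osimplex K n, (0 < n)%N ->
    s ord0 != t ord0 -> (forall i, i != ord0 -> s i = t i) -> o t = ~~ o s.

Record discrete_manifold (R : realType) (n : nat) := DiscreteManifold {
  manifold_complex :> complex;
  manifold_locally_finite : locally_finite manifold_complex;
  manifold_realization : is_manifold R n (realization R manifold_complex);
  manifold_orientation : simplex_orientation manifold_complex n;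
  manifold_oriented : coherent manifold_orientation }.

Record vbundle (R : realType) (K : complex) (r : nat) := VBundle {
  fibre :> vertex K -> vectType R;
  fibre_rank : forall v, \dim {:fibre v} = r }.

(* transport v w is R_(v,w) : E_w -> E_v.  Only its values with v = w or
   {v, w} an edge matter; the other ones are arbitrary. *)
Record connection (R : realType) (K : complex) (r : nat) (E : vbundle R K r) :=
  Connection {
    transport :> forall v w : vertex K, 'Hom(E w, E v);
    transport_id : forall v, transport v v = \1%VF;
    transport_inv : forall v w, v != w -> simplices [fset v; w]%fset ->
      (transport v w \o transport w v)%VF = \1%VF }.

(* Discrete (1,1)-tensor-valued l-forms.  An oriented simplex is an ordered one
   up to even permutations, hence the invariance under S_(l+1) up to sign.
   Only the values of form s v w with v and w vertices of s matter. *)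
Record tensor_form (R : realType) (K : complex) (r : nat) (E : vbundle R K r)
    (l : nat) := TensorForm {
  form :> osimplex K l -> forall v w : vertex K, 'Hom(E w, E v);
  form_alt : forall (s : osimplex K l) (p : 'S_l.+1) (i j : 'I_l.+1),
    form (osimplex_perm s p) (s i) (s j) =
    (-1) ^+ odd_perm p *: form s (s i) (s j) }.

(* Assignments gamma([v_0, ..., v_k], v_0, v_k) on ordered simplices. *)
Definition sided_form (R : realType) (K : complex) (r : nat)
    (E : vbundle R K r) (k : nat) :=
  forall s : osimplex K k, 'Hom(E (s ord_max), E (s ord0)).

Section Curvature.
Variables (R : realType) (K : complex) (r : nat) (E : vbundle R K r).
Variable D : connection E.

Definition vertex_index (k : nat) (s : osimplex K k) (v : vertex K) : 'I_k.+1 :=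
  odflt ord0 [pick i | s i == v].

Lemma vertex_indexK (k : nat) (s : osimplex K k) (i : 'I_k.+1) :
  vertex_index s (s i) = i.
Proof.
rewrite /vertex_index; case: pickP => [j /eqP/overtex_inj //|/(_ i)].
by rewrite eqxx.
Qed.

(* The curvature on the triangle [v, a, b] with evaluation vertex v and cut
   vertex w in {v, a, b}.  In the last case w = v, and the subtracted transport
   is the identity of E_v. *)
Definition curvature_at (v w a b : vertex K) : 'Hom(E w, E v) :=
  if w == a then D v w - (D v b \o D b w)%VF
  else if w == b then (D v a \o D a w)%VF - D v w
  else (D v a \o (D a b \o D b w))%VF - D v w.

(* The triangle s is first rotated cyclically so as to start at the evaluation
   vertex: s = [v, a, b].  For w <> v the formula of curvature_at is alternating,
   and o plays no role (curvature01 and curvature02 below).  For w = v the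
   formulas on [v, a, b] and [v, b, a] give P - 1 and P^-1 - 1, which are not
   opposite: the formula can only be imposed on one orientation of each triangle,
   chosen by o, and determines the value on the other one by antisymmetry. *)
Definition curvature_fun (o : simplex_orientation K 2) (s : osimplex K 2)
    (v w : vertex K) : 'Hom(E w, E v) :=
  let i := vertex_index s v in
  let a := s (ordS i) in
  let b := s (ordS (ordS i)) in
  if o s then curvature_at v w a b else - curvature_at v w b a.

Lemma perm3_ordS (p : 'S_3) (i : 'I_3) :
  p (ordS i) = if odd_perm p then ordS (ordS (p i)) else ordS (p i).
Proof.
have ordS3 (j : 'I_3) : ordS (ordS (ordS j)) = j.
  by apply/val_inj; move: j => [[|[|[|//]]] ?].
case: (prod_tpermP p) => ts -> {p} /= hts.
elim: ts hts i => [_ i|[x y] ts IH /= /andP[xy hts] i].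
  by rewrite big_nil odd_perm1 !perm1.
rewrite big_cons odd_permM odd_tperm /= !permM.
move: xy; rewrite /dpair /= => xy.
have -> : tperm x y (ordS i) = ordS (ordS (tperm x y i)).
  apply/val_inj; rewrite !permE /=; move: x y i xy.
  by move=> [[|[|[|//]]] ?] [[|[|[|//]]] ?] [[|[|[|//]]] ?].
by rewrite !IH // xy /=; case: (odd_perm _) => //=; rewrite ordS3.
Qed.

Lemma curvature_alt (o : simplex_orientation K 2) (s : osimplex K 2) (p : 'S_3)
    (i j : 'I_3) :
  curvature_fun o (osimplex_perm s p) (s i) (s j) =
  (-1) ^+ odd_perm p *: curvature_fun o s (s i) (s j).
Proof.
have ordS3 (k : 'I_3) : ordS (ordS (ordS k)) = k.
  by apply/val_inj; move: k => [[|[|[|//]]] ?].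
have hi : vertex_index (osimplex_perm s p) (s i) = (p^-1)%g i.
  by rewrite -[s i](_ : osimplex_perm s p ((p^-1)%g i) = _)
     ?vertex_indexK //= permKV.
rewrite /curvature_fun hi vertex_indexK positive_perm /= !perm3_ordS permKV.
case: (odd_perm p); rewrite ?addbT ?addbF ?ordS3 ?scale1r // scaleN1r.
by case: (o s); rewrite //= opprK.
Qed.

Definition curvature (o : simplex_orientation K 2) : tensor_form E 2 :=
  TensorForm (curvature_alt o).

Local Notation v0 := (ord0 : 'I_3).
Local Notation v1 := (inord 1 : 'I_3).
Local Notation v2 := (ord_max : 'I_3).

Lemma curvature_ordE (o : simplex_orientation K 2) (s : osimplex K 2) w :
  curvature o s (s v0) w =
  if o s then curvature_at (s v0) w (s v1) (s v2)
  else - curvature_at (s v0) w (s v2) (s v1).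
Proof.
rewrite /= /curvature_fun vertex_indexK.
have -> : ordS v0 = v1 by apply/val_inj; rewrite /= inordK.
by have -> : ordS v1 = v2 by apply/val_inj; rewrite /= inordK.
Qed.

Lemma overtex3_eq (s : osimplex K 2) :
  [/\ (s v0 == s v1) = false, (s v0 == s v2) = false, (s v1 == s v2) = false
    & (s v2 == s v1) = false].
Proof.
by split; apply/negbTE; rewrite (inj_eq (@overtex_inj _ _ s)) -val_eqE /= ?inordK.
Qed.

Lemma curvature01 (o : simplex_orientation K 2) (s : osimplex K 2) :
  curvature o s (s v0) (s v1) =
  D (s v0) (s v1) - (D (s v0) (s v2) \o D (s v2) (s v1))%VF.
Proof.
have [_ _ s12 _] := overtex3_eq s.
rewrite curvature_ordE /curvature_at eqxx s12.
by case: (o s); rewrite // opprB.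
Qed.

Lemma curvature02 (o : simplex_orientation K 2) (s : osimplex K 2) :
  curvature o s (s v0) (s v2) =
  (D (s v0) (s v1) \o D (s v1) (s v2))%VF - D (s v0) (s v2).
Proof.
have [_ _ _ s21] := overtex3_eq s.
rewrite curvature_ordE /curvature_at eqxx s21.
by case: (o s); rewrite // opprB.
Qed.

Lemma curvature00 (o : simplex_orientation K 2) (s : osimplex K 2) : o s ->
  curvature o s (s v0) (s v0) =
  (D (s v0) (s v1) \o (D (s v1) (s v2) \o D (s v2) (s v0)))%VF - \1%VF.
Proof.
have [s01 s02 _ _] := overtex3_eq s.
by move=> os; rewrite curvature_ordE os /curvature_at s01 s02 transport_id.
Qed.

End Curvature.

Section ExteriorCovariantDerivative.
Variables (R : realType) (K : complex) (r : nat) (E : vbundle R K r).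
Variable D : connection E.

Definition sided_derivative (l : nat) (beta : tensor_form E l) :
    sided_form E l.+1 := fun s =>
  let v (i : nat) := s (inord i) in
  let v0 := s ord0 in
  let vmax := s ord_max in
  (D v0 (v 1) \o beta (osimplex_face s ord0) (v 1) vmax)%VF
  + \sum_(1 <= i < l.+1)
      (-1) ^+ i *: beta (osimplex_face s (inord i)) v0 vmax
  + (-1) ^+ l.+1 *:
      (beta (osimplex_face s ord_max) v0 (v l) \o D (v l) vmax)%VF.

(* For k = 0 the index k.-1 is meaningless, but then every permutation is even
   and the second term vanishes. *)
Definition alternation (k : nat) (gamma : sided_form E k) : sided_form E k :=
  fun s =>
  let v0 := s ord0 in
  let vk := s ord_max in
  (k.+1`!)%:R^-1 *: \sum_(p : 'S_k.+1)
    (let sgn : R := (-1) ^+ odd_perm p in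
     let s_p := osimplex_perm s p in
     let w0 := s_p ord0 in
     let wk := s_p ord_max in
     let wk1 := s_p (inord k.-1) in
     ((1 + sgn) / 2) *: (D v0 w0 \o (gamma s_p \o D wk vk))%VF
     + ((sgn - 1) / 2) *: (D v0 w0 \o (gamma s_p \o (D wk wk1 \o D wk1 vk)))%VF).

Definition exterior_covariant_derivative (l : nat) (beta : tensor_form E l) :
  sided_form E l.+1 := alternation (sided_derivative beta).

End ExteriorCovariantDerivative.

(* Main.v *)
Require Import Defs.
From mathcomp Require Import all_boot all_order all_algebra all_reals.

(** The discrete Bianchi identity already holds before alternation.  With
    evaluation at the first and cut at the last vertex, the curvature of an
    ordered triangle [a, b, c] is the defect R_ab R_bc - R_ac between the two
    edge paths from c to a, whatever the orientation chosen on the triangle.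
    On a tetrahedron [a, b, c, d] the sided derivative is therefore the
    alternating sum over faces of such defects,
      R_ab (R_bc R_cd - R_bd) - (R_ac R_cd - R_ad)
        + (R_ab R_bd - R_ad) - (R_ab R_bc - R_ac) R_cd,
    in which every edge path from d to a occurs twice, with opposite signs
    ([sided_bianchi]), by bilinearity and associativity of composition.  This
    holds for every ordering of the vertices, so each of the 24 terms of the
    alternation vanishes ([alternation_eq0]). *)

Set Implicit Arguments.
Unset Strict Implicit.
Unset Printing Implicit Defensive.
Import GRing.Theory.
Local Open Scope ring_scope.

Section Bianchi.
Variables (R : realType) (K : complex) (r : nat) (E : vbundle R K r).
Variable D : connection E.

(** The fibres of the bundle depend on vertices, so that the equalities between
    vertices of a simplex and vertices of its faces cannot be rewritten in the
    type of a form.  Taking the three vertices as variables avoids any cast. *)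
Lemma curvature_ends (o : simplex_orientation K 2) (t : osimplex K 2) a b c :
  t ord0 = a -> t (inord 1) = b -> t ord_max = c ->
  curvature D o t a c = (D a b \o D b c)%VF - D a c.
Proof. by move=> <- <- <-; exact: curvature02. Qed.

Lemma sided_bianchi (o : simplex_orientation K 2) (s : osimplex K 3) :
  sided_derivative D (curvature D o) s = 0.
Proof.
rewrite /sided_derivative big_nat_recr // big_nat1.
have faceE (i : 'I_4) (j : 'I_3) (k : 'I_4) :
    bump i j = k -> osimplex_face s i j = s k.
  by move=> ijk; rewrite /=; congr (s _); apply/val_inj.
(* The witnesses are the middle vertices of the faces bcd, acd, abd, abc. *)
rewrite (@curvature_ends o (osimplex_face s ord0) _ (s (inord 2)));
  try by apply: faceE; rewrite /= ?inordK.
rewrite (@curvature_ends o (osimplex_face s (inord 1)) _ (s (inord 2)));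
  try by apply: faceE; rewrite /= ?inordK.
rewrite (@curvature_ends o (osimplex_face s (inord 2)) _ (s (inord 1)));
  try by apply: faceE; rewrite /= ?inordK.
rewrite (@curvature_ends o (osimplex_face s ord_max) _ (s (inord 1)));
  try by apply: faceE; rewrite /= ?inordK.
rewrite expr1 sqrrN expr1n exprS sqrrN expr1n mulr1 !scaleN1r scale1r.
rewrite comp_lfunDr comp_lfunDl comp_lfunNr comp_lfunNl comp_lfunA.
set abcd := (_ \o _ \o _)%VF; set abd := (D _ _ \o D _ (s ord_max))%VF.
set acd := (D _ (s (inord 2)) \o D _ _)%VF.
(* The single transport from d to a cancels between the faces acd and abd;
   then the sum telescopes. *)
by rewrite !opprB /= [_ - acd + _]addrC !subrKA subrr.
Qed.

Lemma alternation_eq0 k (gamma : sided_form E k) :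
  (forall s, gamma s = 0) -> forall s, alternation D gamma s = 0.
Proof.
move=> gamma0 s; rewrite /alternation big1 ?scaler0 // => p _ /=.
by rewrite gamma0 !comp_lfun0l !comp_lfun0r !scaler0 addr0.
Qed.

End Bianchi.

Theorem proposition5p3 (R : realType) (n : nat) (M : discrete_manifold R n)
  (r : nat) (E : vbundle R M r) (D : connection E)
  (o : simplex_orientation M 2) (s : osimplex M 3) :
  exterior_covariant_derivative D (curvature D o) s = 0.
Proof. exact/alternation_eq0/sided_bianchi. Qed.
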